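(* Let $q$ be a positive integer, let $\mathcal{T}_{q+1}$ be the $(q+1)$-regular tree, and let $\mathrm{Aut}(\mathcal{T}_{q+1})$ be its group of isometries. For every real number $\delta\in\left[0,\tfrac12\log q\right]$ there exists a discrete subgroup $\Gamma$ of $\mathrm{Aut}(\mathcal{T}_{q+1})$ whose critical exponent $\delta_\Gamma$ is equal to $\delta$.
   Context: The tree $\mathcal{T}_{q+1}$ is the (infinite) tree all of whose vertices have degree $q+1$; $V\mathcal{T}_{q+1}$ denotes its vertex set and $d$ its path metric, in which each edge has length $1$. The group $\mathrm{Aut}(\mathcal{T}_{q+1})$ of isometries (graph automorphisms) of $\mathcal{T}_{q+1}$ carries the usual topology of pointwise convergence on vertices; a subgroup $\Gamma$ is discrete if it is discrete in this topology, equivalently if the stabilizer $\Gamma_v$ of every vertex $v\in V\mathcal{T}_{q+1}$ is finite. For a discrete subgroup $\Gamma$ of $\mathrm{Aut}(\mathcal{T}_{q+1})$, the critical exponent of $\Gamma$ is $$\delta_\Gamma=\limsup_{n\to\infty}\frac{\log\#\{\gamma\in\Gamma\colon d(v,\gamma v)\le n\}}{n},$$ where $v\in V\mathcal{T}_{q+1}$ is a fixed vertex; the value does not depend on the choice of $v$. Here $\log$ is the natural logarithm. *)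

(* Defs.v *)
From mathcomp Require Import all_boot all_order all_algebra.
From mathcomp Require Import finmap.
From mathcomp Require Import all_classical all_reals all_analysis.

Set Implicit Arguments.
Unset Strict Implicit.
Unset Printing Implicit Defensive.

Import Order.TTheory GRing.Theory Num.Theory.
Local Open Scope classical_set_scope.
Local Open Scope ring_scope.

Section Tree.
Variables (V : choiceType) (adj : rel V).

Definition connected_graph : Prop :=
  forall x y : V, exists p : seq V, path adj x p /\ last x p = y.

(* The bound on the size excludes the backtracking closed walks [:: x; y] from
   the cycles of a simple graph. *)
Definition acyclic_graph : Prop :=
  forall c : seq V, (2 < size c)%N -> ~ ucycle adj c.

Definition is_tree : Prop :=
  [/\ [set: V] !=set0, symmetric adj, irreflexive adj,
      connected_graph & acyclic_graph].

Definition regular_graph (k : nat) : Prop :=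
  forall x : V, ([set y | adj x y] #= `I_k)%card.

Definition is_regular_tree (k : nat) : Prop := is_tree /\ regular_graph k.

Definition walk_lengths (x y : V) : set nat :=
  [set n | exists p : seq V, [/\ path adj x p, last x p = y & size p = n]].

(* The least element of walk_lengths x y, which is nonempty in a connected
   graph (the default value 0 is then irrelevant). *)
Definition tree_dist (x y : V) : nat :=
  xget 0%N [set n | walk_lengths x y n /\
                    forall m, walk_lengths x y m -> (n <= m)%N].

Definition tree_isometry : set (V -> V) :=
  [set g | bijective g /\
           forall x y : V, tree_dist (g x) (g y) = tree_dist x y].

Definition is_subgroup (G : set (V -> V)) : Prop :=
  [/\ G `<=` tree_isometry,
      G id,
      forall g h, G g -> G h -> G (g \o h)
    & forall g, G g -> exists2 h, G h & cancel g h /\ cancel h g].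

(* Every point of G is isolated in G, for the topology of pointwise convergence
   of maps V -> V where V carries the discrete topology. *)
Definition is_discrete (G : set (V -> V)) : Prop :=
  let G' : set {ptws V -> discrete_topology V} := G in
  G' `<=` isolated G'.

Definition displacement_ball (G : set (V -> V)) (v : V) (n : nat) :
    set (V -> V) :=
  [set g | G g /\ (tree_dist v (g v) <= n)%N].

(* The balls are finite for discrete G in a locally finite tree, so that fset_set
   gives their actual cardinality; the term n = 0 does not affect the limsup. *)
Definition critical_exponent (R : realType) (G : set (V -> V)) (v : V) :
    \bar R :=
  limn_esup (fun n : nat =>
    (ln (#|` fset_set (displacement_ball G v n)|%:R : R) / n%:R)%:E).

End Tree.

(* Main.v *)
(** The groups are parabolic: they fix an end of the tree.  Orient every edge
towards that end, write [p x] for the parent of [x] and [ht x] for its height,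
and label the [q] children of every vertex by Z/q.  A finitely supported
sequence [A] of digits in Z/q acts on the tree by adding [A (ht x)] to the
label of every [x].  Such an element moves [x] by twice the height needed to
climb from [x] to a fixed vertex, and it fixes the vertex at height [j] of the
ray from the root iff [A] vanishes from [j] on.  Restricting the support of [A]
to a set [S] of natural numbers gives a group in which the ray's origin has
trivial stabiliser, with about [q ^ #(S cap [0, n/2))] elements of displacement
at most [n]; its critical exponent is [ln q / 2] times the density of [S],
which can be any number in [0, 1]. *)
Require Import Defs.
From mathcomp Require Import all_boot all_order all_algebra.
From mathcomp Require Import all_classical all_reals all_analysis.
From mathcomp Require Import finmap zify lra.

Set Implicit Arguments.
Unset Strict Implicit.

Import Order.TTheory GRing.Theory Num.Theory numFieldNormedType.Exports.
Local Open Scope classical_set_scope.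
Local Open Scope ring_scope.

(** * Walks, distances and simple paths *)

Lemma tree_dist_leP (V : choiceType) (adj : rel V) (x y : V) (n : nat) :
    walk_lengths adj x y !=set0 ->
  (tree_dist adj x y <= n)%N <-> exists2 m, (m <= n)%N & walk_lengths adj x y m.
Proof.
move=> [n0 wn0].
have exW : exists n, `[< walk_lengths adj x y n >] by exists n0; apply/asboolP.
have [k /asboolP wk kmin] := ex_minnP exW.
(* The minimal length [k] rules out the default value of [xget]. *)
have [wd dmin] : walk_lengths adj x y (tree_dist adj x y) /\
    forall m, walk_lengths adj x y m -> (tree_dist adj x y <= m)%N.
  rewrite /tree_dist; case: xgetP => [d _ []//|/(_ k)[]]; split => // m wm.
  by apply: kmin; apply/asboolP.
split=> [dn|[m mn /dmin dm]]; last exact: leq_trans mn.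
by exists (tree_dist adj x y).
Qed.

Lemma tree_isometry_adj (V : choiceType) (adj : rel V) (g : V -> V) :
  bijective g -> (forall x y, adj (g x) (g y) = adj x y) -> tree_isometry adj g.
Proof.
move=> bg adjg; split => // x y; have [h gK hK] := bg.
suff e : walk_lengths adj (g x) (g y) = walk_lengths adj x y by rewrite /tree_dist e.
have gpath u s : path adj (g u) (map g s) = path adj u s.
  by elim: s u => //= v s IH u; rewrite adjg IH.
apply/seteqP; split=> n [s [ps ls ss]].
  exists (map h s); split; last by rewrite size_map.
    by rewrite -gpath -map_comp (eq_map hK) map_id.
  by rewrite -[x]gK last_map ls gK.
by exists (map g s); rewrite gpath size_map last_map ls.
Qed.

(** From the first vertex where they disagree, two simple paths with the same ends would bound a
    cycle. *)
Lemma simple_path_unique (V : choiceType) (adj : rel V) (adjC : symmetric adj)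
    (adjA : acyclic_graph adj) (x : V) (s t : seq V) :
    path adj x s -> path adj x t -> uniq (x :: s) -> uniq (x :: t) ->
  last x s = last x t -> s = t.
Proof.
elim: s t x => [|a s IH] [|b t] x //.
- by move=> _ _ _ /= /andP[xbt _] e; rewrite e mem_last in xbt.
- by move=> _ _ /= /andP[xas _] _ e; rewrite -e mem_last in xas.
move=> ps pt us ut /= e.
have [eab|nab] := eqVneq a b.
  subst b; congr cons; apply: (IH _ a) => //.
  - by move: ps => /= /andP[].
  - by move: pt => /= /andP[].
  - by move: us => /= /andP[].
  - by move: ut => /= /andP[].
have has_common : has [in b :: t] (a :: s).
  by apply/hasP; exists (last a s); [exact: mem_last|rewrite e /= mem_last].
have [s1 [z [s2 [es zt s1t]]]] : exists s1 z s2,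
    [/\ a :: s = s1 ++ z :: s2, z \in b :: t & ~~ has [in b :: t] s1].
  move: has_common; set P := (X in has X _); move: (a :: s) => u.
  by case/split_find => z s1 s2; exists s1, z, s2; rewrite cat_rcons.
have [t1 [t2 et]] : exists t1 t2, b :: t = t1 ++ z :: t2.
  by case/splitPr: zt => t1 t2; exists t1, t2.
rewrite et {zt} in pt ut s1t; rewrite es {IH} in ps us.
(* Follow s up to its first vertex z on t, and return to x along t. *)
have cyc : ucycle adj (x :: s1 ++ z :: rev t1).
  rewrite /ucycle /=; apply/andP; split.
    rewrite rcons_cat rcons_cons cat_path.
    move: ps pt; rewrite !cat_path /= => /andP[-> /andP[-> _]] /=.
    case/andP=> pt /andP[zt1 _].
    have := rev_path adj x (rcons t1 z).
    rewrite last_rcons belast_rcons rev_cons => ->.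
    by rewrite -(eq_path adjC) rcons_path pt.
  move: us ut; rewrite /= !mem_cat !inE !cat_uniq /= !negb_or mem_rev rev_uniq.
  case/andP=> /and3P[-> -> _] /and3P[-> zs1 _].
  case/andP=> /and3P[-> _ _] /and3P[-> zt1 _] /=.
  rewrite mem_rev; case/andP: zs1 => -> _; case/andP: zt1 => -> _ /=.
  rewrite andbT; apply: contra s1t => /hasP[y]; rewrite mem_rev => yt1 ys1.
  by apply/hasP; exists y => //; rewrite mem_cat yt1.
exfalso; apply: (adjA _ _ cyc).
rewrite /= size_cat /= size_rev.
case: (s1) (t1) es et => [|? ?] [|? ?] /= [ea _] [eb _]; try lia.
by rewrite ea eb eqxx in nab.
Qed.

(** * Orientation of a regular tree towards an end *)

Lemma regular_graph_neighbours (V : choiceType) (adj : rel V) (k : nat) (x : V) :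
    regular_graph adj k ->
  exists s : seq V, [/\ uniq s, size s = k & forall y, (y \in s) = adj x y].
Proof.
move=> /(_ x) hk; have fin : finite_set [set y | adj x y] by exists k.
exists (enum_fset (fset_set [set y | adj x y])); split; first exact: fset_uniq.
  exact: card_fset_set.
by move=> y; have := in_fset_set fin y; rewrite mem_setE.
Qed.

(** An infinite ray [v] is built from a base vertex [r]; [p] moves forward along the ray and towards
    [r] off it, so every orbit of [p] ends up following the ray. *)
Lemma regular_tree_parent (V : choiceType) (adj : rel V) (q : nat) :
    (0 < q)%N -> is_regular_tree adj q.+1 ->
  exists p : V -> V,
    [/\ forall x y, adj x y = (y == p x) || (x == p y),
        forall x y, exists m n, iter m p x = iter n p y
      & forall m x, iter m.+1 p x <> x].
Proof.
move=> q0 [[[r _] adjC adjI adjconn adjA] reg].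
have uniqP := simple_path_unique adjC adjA.
have /choice[P hP] : forall x, exists s : seq V,
    [/\ path adj r s, uniq (r :: s) & last r s = x].
  move=> x; have [s [ps sx]] := adjconn r x.
  by move: sx; case: (shortenP ps) => s' ps' us' _ <-; exists s'.
have PE x s : path adj r s -> uniq (r :: s) -> last r s = x -> P x = s.
  by have [ps us lx] := hP x; move=> ps' us' e; apply: (uniqP r); rewrite // lx e.
have Pinj x y : P x = P y -> x = y.
  by have [_ _ {2}<-] := hP x; have [_ _ {2}<-] := hP y; move=> ->.
have adjP x y : adj x y -> P y = rcons (P x) y \/ P x = rcons (P y) x.
  move=> xy; have [px ux lx] := hP x.
  have [yPx|yPx] := boolP (y \in r :: P x); last first.
    left; apply: PE; last by rewrite last_rcons.
      by rewrite rcons_path px lx.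
    by rewrite -rcons_cons rcons_uniq yPx.
  (* Here [y] already lies on the path to [x]; by uniqueness the rest [s2] of that path is the
     single edge from [y] to [x]. *)
  right; have [s1 [s2 [Px ys1]]] : exists s1 s2, P x = s1 ++ s2 /\ last r s1 = y.
    by case/splitPl: yPx => s1 s2; exists s1, s2.
  move: px ux lx; rewrite Px cat_path ys1 -cat_cons cat_uniq last_cat ys1.
  move=> /andP[ps1 ps2] /and3P[us1 s12 us2] ls2.
  rewrite (PE y s1)// -cats1; congr cat; apply: (uniqP y) => //=.
  - by rewrite adjC xy.
  - rewrite us2 andbT; apply: contra s12 => ys2; apply/hasP; exists y => //.
    by rewrite -ys1 mem_last.
  - by rewrite inE andbT; apply/eqP => e; rewrite e adjI in xy.
(* As [q] is positive, [x] has two neighbours; if both were nearer to [r], they would have the same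
   path from [r] and be equal. *)
have /choice[ch chP] : forall x, exists y, adj x y /\ P y = rcons (P x) y.
  move=> x; have [[|y1 [|y2 s]] [us ss hs]] := regular_graph_neighbours x reg.
  - by [].
  - by case: ss q0 => <-.
  have xy1 : adj x y1 by rewrite -hs inE eqxx.
  have xy2 : adj x y2 by rewrite -hs !inE eqxx orbT.
  have [e1|e1] := adjP _ _ xy1; first by exists y1.
  have [e2|e2] := adjP _ _ xy2; first by exists y2.
  have : rcons (P y1) x == rcons (P y2) x by rewrite -e1 -e2.
  rewrite eqseq_rcons eqxx andbT => /eqP/Pinj e12.
  by move: us; rewrite /= e12 inE eqxx.
have /choice[par parP] : forall x, exists y,
    x <> r -> adj y x /\ P x = rcons (P y) x.
  (* The value at [r] is a dummy: [r] lies on the ray, where [p] uses [ch]. *)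
  move=> x; have [->|xr] := eqVneq x r; first by exists r.
  have [px ux lx] := hP x.
  case/lastP Px: (P x) px ux lx => [|s z].
    by move=> _ _ /= e; rewrite e eqxx in xr.
  rewrite rcons_path -rcons_cons rcons_uniq last_rcons.
  move=> /andP[ps sz] /andP[_ us] ezx; rewrite ezx in sz Px.
  by exists (last r s) => _; rewrite (PE _ s) ?ezx.
have Pr : P r = [::] by apply: PE.
pose v i := iter i ch r.
have sv i : size (P (v i)) = i.
  by elim: i => [|i IH]; rewrite /v /= ?Pr// (chP _).2 size_rcons IH.
pose p x := if x == v (size (P x)) then ch x else par x.
have pv i : p (v i) = v i.+1 by rewrite /p sv eqxx.
have pvn m i : iter m p (v i) = v (m + i)%N.
  by elim: m => //= m ->; rewrite pv.
have par_r x : x != v (size (P x)) -> x <> r.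
  by move=> + e; rewrite e Pr /= /v /= eqxx.
have reach x : exists m i, iter m p x = v i.
  have [n] := ubnP (size (P x)); elim: n x => // n IH x.
  have [e _|nr] := eqVneq x (v (size (P x))); first by exists 0, (size (P x)).
  have [_ Px] := parP x (par_r x nr); rewrite Px size_rcons ltnS => /IH[m [i mi]].
  by exists m.+1, i; rewrite iterSr {2}/p (negbTE nr).
have half x y : P y = rcons (P x) y -> (y == p x) || (x == p y).
  move=> Py; have [e|nr] := eqVneq y (v (size (P y))); last first.
    have [_ Py'] := parP y (par_r y nr).
    rewrite orbC /p (negbTE nr); move/eqP: Py'; rewrite {1}Py eqseq_rcons.
    by case/andP => /eqP/Pinj -> _; rewrite eqxx.
  have ey : y = ch (v (size (P x))) by rewrite {1}e Py size_rcons.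
  have [_] := chP (v (size (P x))); rewrite -ey Py => /eqP.
  rewrite eqseq_rcons => /andP[/eqP/Pinj ex _].
  by rewrite /p -ex eqxx {1}ey -ex eqxx.
exists p; split.
- move=> x y; apply/idP/idP.
    by case/adjP => /half //; rewrite orbC.
  have adjp z : adj z (p z).
    rewrite /p; case: ifPn => [_|nr]; first exact: (chP z).1.
    by rewrite adjC; exact: (parP z (par_r z nr)).1.
  by case/orP => /eqP ->; rewrite // adjC.
- move=> x y; have [m [i mi]] := reach x; have [n [j nj]] := reach y.
  by exists (j + m)%N, (i + n)%N; rewrite !iterD mi nj !pvn addnC.
- move=> m x mx.
  have [k [i ki]] := reach x.
  (* Going [k] times round the supposed cycle takes at least [k] steps, so [x] lies on the ray; but
     there [p] strictly increases the distance to [r]. *)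
  have iterx l : iter (l * m.+1) p x = x.
    by elim: l => // l IH; rewrite mulSn iterD IH.
  have xv : x = v (k * m + i)%N.
    by rewrite -pvn -ki -iterD -mulnSr iterx.
  rewrite xv pvn in mx; have := sv (m.+1 + (k * m + i))%N.
  by rewrite mx sv; lia.
Qed.

(** The height compares the climbs from [r] and from [x] to a common ancestor; since [p] has no
    cycles, the choice of ancestor does not matter. *)
Lemma regular_tree_height_labels (V : choiceType) (adj : rel V) (q : nat) :
    is_regular_tree adj q.+2 ->
  exists (p : V -> V) (r : V) (ht : V -> int) (lab : V -> 'I_q.+1)
      (down : V -> 'I_q.+1 -> V),
    [/\ forall x y, adj x y = (y == p x) || (x == p y),
        forall x y, exists m n, iter m p x = iter n p y,
        ht r = 0 /\ forall x, ht (p x) = ht x + 1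
      & [/\ forall y c, p (down y c) = y, forall y c, lab (down y c) = c
          & forall x, down (p x) (lab x) = x]].
Proof.
move=> hT; have [p [adjE conf aper]] := regular_tree_parent (ltn0Sn q) hT.
have [[[r _] adjC adjI _ _] reg] := hT.
have iterI x m n : iter m p x = iter n p x -> m = n.
  wlog mn : m n / (m <= n)%N.
    move=> H; have [|/ltnW] := leqP m n; first exact: H.
    by move=> nm e; apply/esym; apply: H => //; rewrite e.
  rewrite -{1}(subnK mn) iterD; case: (n - m)%N (subnK mn) => [|k]; first by lia.
  by move=> _ /esym /aper.
have /choice[hk hkP] : forall x, exists kl : nat * nat,
    iter kl.1 p x = iter kl.2 p r.
  by move=> x; have [k [l e]] := conf x r; exists (k, l).
pose ht x : int := (hk x).2%:Z - (hk x).1%:Z.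
(* C y lists the children of y; the label of a vertex is its rank in that list. *)
have /choice[C CP] : forall y, exists s : seq V,
    [/\ uniq s, size s = q.+1 & forall x, (x \in s) = (p x == y)].
  move=> y; have [s [us ss hs]] := regular_graph_neighbours y reg.
  have pys : p y \in s by rewrite hs adjE eqxx.
  exists (rem (p y) s); split; first exact: rem_uniq.
    by rewrite size_rem // ss.
  move=> x; rewrite mem_rem_uniq // !inE hs adjE [y == p x]eq_sym.
  have [->|//] := eqVneq x (p y); apply/esym/negbTE/eqP => e.
  by apply: (aper 1%N y); rewrite /= e.
pose lab x : 'I_q.+1 := inord (index x (C (p x))).
pose down y (c : 'I_q.+1) := nth y (C y) c.
have down_in y c : down y c \in C y.
  by have [_ sC _] := CP y; rewrite mem_nth // sC.
have pdown y c : p (down y c) = y.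
  by have [_ _ hC] := CP y; apply/eqP; rewrite -hC.
exists p, r, ht, lab, down; split => //; split => //.
- by apply/eqP; rewrite subr_eq0; apply/eqP; rewrite (iterI _ _ _ (hkP r)).
- move=> x; have := hkP (p x); have := hkP x; rewrite /ht.
  case: (hk x) (hk (p x)) => k l [a b] /= ekl; rewrite -iterSr => eab.
  have : (k + b = a.+1 + l)%N.
    by apply: (iterI r); rewrite !iterD -eab -ekl -!iterD addnC.
  lia.
- move=> y c; rewrite /lab pdown /down; have [uC sC _] := CP y.
  by rewrite index_uniq ?sC // inord_val.
- move=> x; have [uC sC hC] := CP (p x); rewrite /down /lab.
  have xC : x \in C (p x) by rewrite hC.
  by rewrite inordK ?nth_index // -sC index_mem.
Qed.

(** * Shifts: automorphisms that add digits to the labels *)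

Section HorocyclicGroup.
Variables (V : choiceType) (adj : rel V) (q : nat) (p : V -> V) (r : V).
Variables (ht : V -> int) (lab : V -> 'I_q.+1) (down : V -> 'I_q.+1 -> V).
Hypothesis adjE : forall x y, adj x y = (y == p x) || (x == p y).
Hypothesis confluent : forall x y, exists m n, iter m p x = iter n p y.
Hypothesis ht_root : ht r = 0.
Hypothesis htp : forall x, ht (p x) = ht x + 1.
Hypothesis p_down : forall y c, p (down y c) = y.
Hypothesis lab_down : forall y c, lab (down y c) = c.
Hypothesis down_lab : forall x, down (p x) (lab x) = x.

Lemma ht_iter m x : ht (iter m p x) = ht x + m%:Z.
Proof. by elim: m => [|m IH]; rewrite ?addr0 //= htp IH; lia. Qed.

Lemma child_inj x y : p x = p y -> lab x = lab y -> x = y.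
Proof. by move=> pe le; rewrite -(down_lab x) pe le down_lab. Qed.

(** Labels at negative heights are left alone, so that only the identity shift fixes [r]. *)
Definition digit (A : nat -> 'I_q.+1) (h : int) : 'I_q.+1 :=
  if h is Posz n then A n else 0.

(** The last clause forces [A] to have finite support and gives a level from which the other two
    determine [g] downwards. *)
Definition is_shift (A : nat -> 'I_q.+1) (g : V -> V) : Prop :=
  [/\ forall x, p (g x) = g (p x),
      forall x, lab (g x) = lab x + digit A (ht x)
    & exists N : int, forall x, N <= ht x -> g x = x].

Lemma shift_iter A g m x : is_shift A g -> iter m p (g x) = g (iter m p x).
Proof. by case=> gp _ _; elim: m => //= m ->. Qed.

Lemma iter_ht_ge (N : int) x : exists m, forall k, (m <= k)%N -> N <= ht (iter k p x).
Proof. by exists `|N - ht x|%N => k mk; rewrite ht_iter; lia. Qed.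

(** A high enough ancestor of [x] is fixed, hence is reached from [x] and [g x] in equally many
    steps. *)
Lemma shift_ht A g x : is_shift A g -> ht (g x) = ht x.
Proof.
move=> gA; have [_ _ [N gN]] := gA; have [m /(_ m (leqnn m))/gN e] := iter_ht_ge N x.
by apply: (addIr m%:Z); rewrite -!ht_iter (shift_iter _ _ gA) e.
Qed.

(* Two such maps agree high up on the path from x to the end, hence at x since
   a vertex is determined by its parent and its label. *)
Lemma shift_unique A f g : is_shift A f -> is_shift A g -> f = g.
Proof.
move=> [fp fl [M fM]] [gp gl [N gN]]; apply/funext => x.
have [m Mm] := iter_ht_ge M x; have [n Nn] := iter_ht_ge N x.
have: f (iter (maxn m n) p x) = g (iter (maxn m n) p x).
  by rewrite fM ?gN ?Mm ?Nn ?leq_maxl ?leq_maxr.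
elim: (maxn m n) => //= k IH e; apply: IH; apply: child_inj.
  by rewrite fp gp.
by rewrite fl gl.
Qed.

(* As A vanishes at large heights, the value does not depend on m once iter m p x
   is high enough. *)
Fixpoint shift_upto (A : nat -> 'I_q.+1) (m : nat) (x : V) : V :=
  if m is m'.+1 then down (shift_upto A m' (p x)) (lab x + digit A (ht x)) else x.

Lemma shift_exists A N : (forall i, (N <= i)%N -> A i = 0) -> exists g, is_shift A g.
Proof.
move=> AN; have A0 h : N%:Z <= h -> digit A h = 0 by case: h => //= n /AN.
have fix_high m x : N%:Z <= ht x -> shift_upto A m x = x.
  elim: m x => //= m IH x Nx; rewrite A0 // addr0 IH ?down_lab //.
  by rewrite htp; lia.
have stable m x : N%:Z - ht x <= m%:Z -> shift_upto A m.+1 x = shift_upto A m x.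
  elim: m x => [|m IH] x Nx; first by rewrite fix_high //; lia.
  rewrite -[LHS]/(down (shift_upto A m.+1 (p x)) (lab x + digit A (ht x))).
  by rewrite IH // htp; lia.
(* This many steps lead from [x] up to height [N]; if [x] is already higher, the extra steps are
   harmless by [fix_high]. *)
pose g x := shift_upto A `|N%:Z - ht x|%N x.
have gE m x : N%:Z - ht x <= m%:Z -> g x = shift_upto A m x.
  move=> Nm; have [Nx|/ltW Nx] := leP N%:Z (ht x); first by rewrite /g !fix_high.
  have -> : m = ((m - `|N%:Z - ht x|) + `|N%:Z - ht x|)%N by lia.
  by elim: (m - _)%N => // k IH; rewrite addSn stable // ; lia.
have gS x : g x = down (g (p x)) (lab x + digit A (ht x)).
  rewrite (gE `|N%:Z - ht x|.+1 x); last by lia.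
  by rewrite /= -gE // htp; lia.
exists g; split.
- by move=> x; rewrite gS p_down.
- by move=> x; rewrite gS lab_down.
- by exists N%:Z => x Nx; rewrite /g fix_high.
Qed.

Lemma digitD A B h : digit (fun i => A i + B i) h = digit A h + digit B h.
Proof. by case: h => //= _; rewrite addr0. Qed.

Lemma is_shift0 : is_shift (fun=> 0) id.
Proof. by split=> // [x|]; [case: (ht x) => *; rewrite /= addr0|exists 0]. Qed.

(** As [g] preserves heights, both maps add the digit of the same index. *)
Lemma is_shiftD A B f g : is_shift A f -> is_shift B g ->
  is_shift (fun i => A i + B i) (f \o g).
Proof.
move=> fA gB; have [fp fl [M fM]] := fA; have [gp gl [N gN]] := gB; split.
- by move=> x /=; rewrite fp gp.
- by move=> x /=; rewrite fl gl (shift_ht _ gB) digitD addrA addrAC.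
- exists (Num.max M N) => x; rewrite ge_max => /andP[Mx Nx] /=.
  by rewrite gN // fM.
Qed.

(** The [i]-th ancestor of [r] has height [i]; once it is fixed, its label shows that [A i] is 0. *)
Lemma shift_support A g : is_shift A g -> exists N, forall i, (N <= i)%N -> A i = 0.
Proof.
move=> [_ gl [N gN]]; exists `|N|%N => i Ni.
have hi : ht (iter i p r) = i by rewrite ht_iter ht_root add0r.
have := gl (iter i p r); rewrite gN hi /=; last by lia.
by move=> /eqP; rewrite -subr_eq0 opprD addNKr oppr_eq0 => /eqP.
Qed.

Lemma shift_inverse A g : is_shift A g ->
  exists h, [/\ is_shift (fun i => - A i) h, cancel g h & cancel h g].
Proof.
move=> gA; have [N AN] := shift_support gA.
have [|h hA] := @shift_exists (fun i => - A i) N; first by move=> i /AN ->; rewrite oppr0.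
exists h; split => // x.
- have := is_shiftD hA gA; under eq_fun do rewrite addNr.
  by move=> /(shift_unique is_shift0)/(congr1 (@^~ x)).
- have := is_shiftD gA hA; under eq_fun do rewrite subrr.
  by move=> /(shift_unique is_shift0)/(congr1 (@^~ x)).
Qed.

Lemma shift_adj A g x y : is_shift A g -> adj (g x) (g y) = adj x y.
Proof.
move=> gA; have [h [_ gK _]] := shift_inverse gA; have [gp _ _] := gA.
by rewrite !adjE !gp !(can_eq gK).
Qed.

(** Agreement at one vertex passes to all its ancestors, whose labels reveal the digits from [j]
    on. *)
Lemma shift_eq_digits A B f g j : is_shift A f -> is_shift B g ->
  f (iter j p r) = g (iter j p r) -> forall i, (j <= i)%N -> A i = B i.
Proof.
move=> fA gB e i ji; have [_ fl _] := fA; have [_ gl _] := gB.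
have hi : ht (iter i p r) = i by rewrite ht_iter ht_root add0r.
have ei : f (iter i p r) = g (iter i p r).
  by rewrite -(subnK ji) iterD -(shift_iter _ _ fA) e (shift_iter _ _ gB).
by have := fl (iter i p r); rewrite ei gl hi /= => /addrI.
Qed.

(** Descending from a fixed high ancestor, only zero digits are met, so parent and label stay the
    same at each step. *)
Lemma shift_fix A g j : is_shift A g -> (forall i, (j <= i)%N -> A i = 0) ->
  g (iter j p r) = iter j p r.
Proof.
move=> gA Aj; have [gp gl [N gN]] := gA.
suff fix_high m x : j%:Z <= ht x -> g (iter m p x) = iter m p x -> g x = x.
  have [m /(_ m (leqnn m))/gN e] := iter_ht_ge N (iter j p r).
  by apply: fix_high e; rewrite ht_iter ht_root.
elim: m x => // m IH x jx; rewrite iterSr => /IH e.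
apply: child_inj; first by rewrite gp e // htp; lia.
rewrite gl; case: (ht x) jx => // n jn; rewrite /= Aj ?addr0 //.
Qed.

(** * Displacement of a shift *)

Lemma walk_common_ancestor x s : path adj x s ->
  exists i j, (i + j <= size s)%N /\ iter i p x = iter j p (last x s).
Proof.
elim: s x => [|y s IH] x /=; first by exists 0%N, 0%N.
case/andP; rewrite adjE => xy /IH[i [j [ij e]]].
case/orP: xy => /eqP exy; first by exists i.+1, j; rewrite iterSr -exy.
(* A first step down cancels the first step up from [y], if there is one; otherwise it lengthens the
   descent. *)
case: i ij e => [|i] ij e; first by exists 0%N, j.+1; rewrite /= -e exy.
by exists i, j; rewrite -e iterSr -exy; split=> //; lia.
Qed.

Lemma walk_up m x : path adj x (traject p (p x) m).
Proof. by elim: m x => //= m IH x; rewrite IH adjE eqxx. Qed.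

Lemma walk_through_ancestor m x y : iter m p x = iter m p y ->
  walk_lengths adj x y (m + m)%N.
Proof.
move=> e; have adjC : symmetric adj.
  by move=> u v; rewrite !adjE orbC; congr (_ || _); rewrite eq_sym.
exists (traject p (p x) m ++ rev (belast y (traject p (p y) m))).
rewrite cat_path walk_up size_cat size_rev size_belast last_cat !size_traject.
rewrite last_traject e -last_traject rev_path (eq_path (e' := adj)) ?walk_up //.
by split=> //; case: m {e} => //= m; rewrite rev_cons last_rcons.
Qed.

Lemma shift_displacement A g n x : is_shift A g ->
  (tree_dist adj x (g x) <= n)%N <-> g (iter n./2 p x) = iter n./2 p x.
Proof.
move=> gA; have [_ _ [N gN]] := gA.
have [M /(_ _ (leqnn M))/gN fixM] := iter_ht_ge N x.
have walk m : g (iter m p x) = iter m p x -> walk_lengths adj x (g x) (m + m)%N.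
  by move=> e; apply: walk_through_ancestor; rewrite (shift_iter _ _ gA) e.
rewrite tree_dist_leP; last by exists (M + M)%N; apply: walk.
split=> [[m mn [s [ps ls ss]]]|/walk]; last first.
  by exists (n./2 + n./2)%N => //; lia.
have [i [j [ij]]] := walk_common_ancestor ps.
rewrite ls (shift_iter _ _ gA) => e.
(* Equal heights of [x] and [g x] make both climbs equally long, so each has at most [n./2]
   steps. *)
have eij : i = j.
  have := congr1 ht e; rewrite (shift_ht _ gA) !ht_iter; lia.
rewrite -eij in e ij.
have le : (i <= n./2)%N by lia.
by rewrite -(subnK le) iterD -(shift_iter _ _ gA) -e.
Qed.

(** * The groups: discreteness and counting *)

Definition shift_group (S : pred nat) : set (V -> V) :=
  [set g | exists2 A, forall i, ~~ S i -> A i = 0 & is_shift A g].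

Lemma shift_group_subgroup S : is_subgroup adj (shift_group S).
Proof.
split.
- move=> g [A _ gA]; apply: tree_isometry_adj => [|x y]; last exact: shift_adj gA.
  by have [h [_ gK hK]] := shift_inverse gA; exists h.
- by exists (fun=> 0) => //; exact: is_shift0.
- move=> f g [A SA fA] [B SB gB]; exists (fun i => A i + B i); last exact: is_shiftD.
  by move=> i Si; rewrite SA // SB // addr0.
- move=> g [A SA gA]; have [h [hA gK hK]] := shift_inverse gA.
  by exists h => //; exists (fun i => - A i) => // i Si; rewrite SA // oppr0.
Qed.

(** The maps with the same value at [r] as [g] form an open set; it meets the group only in [g],
    since the image of [r] determines all digits. *)
Lemma shift_group_discrete S : is_discrete (shift_group S).
Proof.
move=> g gS /=; split; first exact: mem_set.
pose U : set {ptws V -> discrete_topology V} := [set f | f r = g r].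
exists U.
  have := @proj_continuous V (fun=> discrete_topology V) r g.
  move=> /(_ [set g r]); apply; exact: (@discrete_set1 (discrete_topology V)).
apply/seteqP; split=> f /=.
  move=> [fr [B SB fB]]; have [A SA gA] := gS.
  have AB : A = B.
    by apply/funext => i; apply/esym; apply: (shift_eq_digits (j := 0%N) fB gA).
  by apply: shift_unique gA; rewrite AB.
by move=> ->; split.
Qed.

(** Fixing the vertex at height [j] means that the digits vanish from [j] on, which leaves a free
    digit at each element of [S] below [j]. *)
Lemma stabilizer_card S j :
  #|` fset_set [set g | shift_group S g /\ g (iter j p r) = iter j p r]| =
  (q.+1 ^ #|[pred i : 'I_j | S i]|)%N.
Proof.
pose ext (f : {ffun 'I_j -> 'I_q.+1}) (i : nat) : 'I_q.+1 := oapp f 0 (insub i).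
have extE f (k : 'I_j) : ext f k = f k by rewrite /ext valK.
have ext0 f i : (j <= i)%N -> ext f i = 0.
  by move=> ji; rewrite /ext insubN // -leqNgt.
have /choice[Phi PhiP] : forall f, exists g, is_shift (ext f) g.
  by move=> f; apply: shift_exists (ext0 f).
pose F := pffun_on (0 : 'I_q.+1) [pred i : 'I_j | S i] predT.
have PhiI : {in F &, injective Phi}.
  move=> f f' _ _ e; apply/ffunP => k; rewrite -!extE.
  apply: (shift_eq_digits (j := 0%N) (PhiP f) (PhiP f')) => //.
  by rewrite e.
rewrite -[q.+1 in RHS]card_ord -(card_pffun_on 0) -/F.
suff -> : [set g | shift_group S g /\ g (iter j p r) = iter j p r] =
    [set` [fset Phi f | f in F]%fset].
  by rewrite set_fsetK card_in_imfset //= -cardE.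
apply/seteqP; split=> g /=.
  move=> [[A SA gA] gfix]; apply/imfsetP => /=.
  have Aj : forall i, (j <= i)%N -> A i = 0.
    by apply: (shift_eq_digits gA is_shift0).
  exists [ffun k : 'I_j => A k].
    apply/pffun_onP; split; last by move=> ? _.
    by apply/fintype.subsetP => k; rewrite !inE ffunE; apply: contraR => /SA ->.
  apply: shift_unique gA _.
  suff {1}-> : A = ext [ffun k : 'I_j => A k] by exact: PhiP.
  apply/funext => i; have [ij|ji] := ltnP i j; last by rewrite Aj // ext0.
  by rewrite (extE _ (Ordinal ij)) ffunE.
move=> /imfsetP[/= f /pffun_onP[/fintype.subsetP fS _] ->]; split.
  exists (ext f) => // i Si; have [ij|] := ltnP i j; last exact: ext0.
  rewrite (extE _ (Ordinal ij)); apply/eqP; apply: contraNT Si => fi.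
  by have := fS (Ordinal ij); apply.
by apply: (shift_fix (PhiP f)) => i; exact: ext0.
Qed.

(** Once the path from [x] has joined the ray from [r], the condition at [x] becomes one on the ray,
    with a bounded change of height. *)
Lemma displacement_ball_shift_group S x : exists a b, forall n,
  (a <= n./2)%N -> displacement_ball adj (shift_group S) x n =
    [set g | shift_group S g /\
             g (iter (n./2 - a + b) p r) = iter (n./2 - a + b) p r].
Proof.
have [a [b e]] := confluent x r; exists a, b => n an.
apply/seteqP; split=> g [gS gn]; have [A _ gA] := gS; split=> //.
  by move/(shift_displacement _ _ gA): gn; rewrite -{1 2}(subnK an) iterD e -iterD.
by apply/(shift_displacement _ _ gA); rewrite -(subnK an) iterD e -iterD.
Qed.

End HorocyclicGroup.

(** * Prescribed density and the resulting growth rate *)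

Lemma card_jumps (c : nat -> nat) (j : nat) : c 0%N = 0%N ->
    (forall i, (c i <= c i.+1 <= (c i).+1)%N) ->
  #|[pred i : 'I_j | c i != c i.+1]| = c j.
Proof.
move=> c0 cS; rewrite -sum1_card big_mkcond /=.
elim: j => [|j IH]; first by rewrite big_ord0.
rewrite big_ord_recr /= {}IH; have := cS j; rewrite inE.
by case: eqVneq => /=; lia.
Qed.

(** [S] consists of the jumps of the integer part of [theta * j], which grows by 0 or 1 at each step
    because [theta] is in [0, 1]. *)
Lemma exists_density (R : realType) (theta : R) : 0 <= theta <= 1 ->
  exists S : pred nat, forall j,
    (#|[pred i : 'I_j | S i]|)%:R <= theta * j%:R < (#|[pred i : 'I_j | S i]|)%:R + 1.
Proof.
move=> /andP[t0 t1]; pose c j := Num.truncn (theta * j%:R).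
have cP j : (c j)%:R <= theta * j%:R < (c j)%:R + 1.
  by rewrite natr1; apply: truncn_itv; rewrite mulr_ge0.
exists (fun i => c i != c i.+1) => j; rewrite card_jumps //.
  by rewrite /c mulr0 truncn0.
move=> i; rewrite -ltnS -(ltr_nat R) -[X in _ && X]ltnS -[X in _ && X](ltr_nat R).
have /andP[] := cP i; have /andP[] := cP i.+1; rewrite -!natr1 => *; lra.
Qed.

Lemma half_growth_rate (R : realType) (theta L : R) (c : nat -> nat) (a b : nat) :
    0 <= theta <= 1 -> 0 <= L ->
    (forall j, (c j)%:R <= theta * j%:R < (c j)%:R + 1) ->
  (c (n./2 - a + b)%N)%:R * L / n%:R @[n --> \oo] --> 2^-1 * theta * L.
Proof.
move=> /andP[t0 t1] L0 cP; apply/cvgrPdist_le => e e0.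
(* Replacing [theta * n / 2] by [c j] costs at most [a + b] for the change of base point, 1 for the
   rounding in [c] and 1/2 for the parity of [n]. *)
pose C : R := (a + b + 2)%:R * L.
near=> n.
have n0 : (0 : R) < n%:R by near: n; exact: nbhs_infty_gtr.
have Ce : C / e <= n%:R by near: n; exact: nbhs_infty_ger.
have an : (a <= n./2)%N.
  by near: n; exists a.*2 => // n /=; lia.
set j := (n./2 - a + b)%N; have /andP[c1 c2] := cP j.
have nj : (n%:R : R) = 2 * j%:R + 2 * a%:R - 2 * b%:R + (odd n)%:R.
  have : (n + b + b = j + j + a + a + odd n)%N by rewrite /j; lia.
  by move=> /(congr1 (fun k => k%:R : R)); rewrite !natrD; lra.
have -> : 2^-1 * theta * L - (c j)%:R * L / n%:R =
    (2^-1 * theta * n%:R - (c j)%:R) * L / n%:R.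
  by rewrite !mulrBl; congr (_ - _); rewrite [in RHS](mulrAC _ n%:R) mulfK ?gt_eqF.
rewrite !normrM normfV (ger0_norm L0) (gtr0_norm n0).
rewrite ler_pdivrMr // (le_trans (y := C)) //; last first.
  by rewrite mulrC -ler_pdivrMr.
rewrite ler_wpM2r // ler_norml !natrD nj.
have bnd (k : nat) : 0 <= theta * k%:R <= k%:R by rewrite mulr_ge0 //= ler_piMl.
have /andP[a1 a2] := bnd a; have /andP[b1 b2] := bnd b.
have /andP[d1 d2] := bnd (odd n); have d3 : (odd n)%:R <= 1 :> R by case: odd.
apply/andP; split; lra.
Unshelve. all: by end_near. Qed.
Theorem theorem1p1 (R : realType) (q : nat) (hq : (0 < q)%N)
    (V : choiceType) (adj : rel V) (hT : is_regular_tree adj q.+1)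
    (delta : R) (hdelta : 0 <= delta <= 2^-1 * ln (q%:R : R)) :
  exists Gamma : set (V -> V),
    [/\ is_subgroup adj Gamma,
        is_discrete Gamma
      & forall v : V, critical_exponent adj R Gamma v = delta%:E].
Proof.
case: q hq hT hdelta => // q _ hT /andP[d0 dq].
have L0 : 0 <= ln (q.+1%:R : R) by rewrite ln_ge0 // ler1n.
(* If the tree is a line, the logarithm is 0: then [theta] is 0 by the convention for division, and
   [delta] is 0 as well. *)
pose theta := 2 * delta / ln (q.+1%:R : R).
have thetaE : 2^-1 * theta * ln q.+1%:R = delta.
  rewrite /theta; have [L|L] := eqVneq (ln (q.+1%:R : R)) 0; last first.
    by rewrite mulrA mulfVK // mulKf.
  by rewrite L mulr0; rewrite L in dq; lra.
have theta01 : 0 <= theta <= 1.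
  rewrite /theta divr_ge0 ?mulr_ge0 //=.
  have [->|L] := eqVneq (ln (q.+1%:R : R)) 0; first by rewrite invr0 mulr0.
  by rewrite ler_pdivrMr ?lt_neqAle 1?eq_sym ?L //; lra.
have [S SP] := exists_density theta01.
have [p [r [ht [lab [down [adjE conf [htr htp] [pd ld dl]]]]]]] :=
  regular_tree_height_labels hT.
exists (shift_group p ht lab S); split.
- exact: (shift_group_subgroup adjE htr htp pd ld dl).
- exact: (shift_group_discrete htr htp dl).
move=> v; have [a [b ballE]] :=
  displacement_ball_shift_group lab adjE conf htr htp S v.
rewrite -thetaE.
rewrite /critical_exponent; apply: (cvg_limn_einf_sup _).2.
apply: cvg_EFin; first exact: nearW.
apply: cvg_trans (half_growth_rate a b theta01 L0 SP).
(* The ball is a stabiliser only once [n./2] reaches [a], which suffices for the limit. *)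
apply: near_eq_cvg; near=> n; rewrite /= ballE; last first.
  by near: n; exists a.*2 => // n /=; lia.
rewrite (stabilizer_card htr htp pd ld dl) natrX lnXn ?ltr0n // mulr_natl.
Unshelve. all: by end_near. Qed.
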